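(* Let $k\ge 1$ be an integer. Then the complete graph $K_{2k}$ has a perfect odd cover if and only if $k\equiv 0,1\pmod 4$ and $k\ne 5$.
   Context: $K_n$ denotes the complete graph on $n$ vertices. A biclique is a complete bipartite graph; a biclique on a subset of $V(K_n)$ is given by two disjoint sets $X,Y\subseteq V(K_n)$, its edges being all pairs $xy$ with $x\in X$, $y\in Y$. An odd cover of $K_n$ is a finite collection of bicliques on subsets of $V(K_n)$ such that every edge of $K_n$ belongs to an odd number of the bicliques in the collection. A perfect odd cover of $K_{2k}$ is an odd cover of $K_{2k}$ consisting of exactly $k$ bicliques. *)

(* Defs.v *)
From mathcomp Require Import all_boot.

Set Implicit Arguments.
Unset Strict Implicit.
Unset Printing Implicit Defensive.

Definition complete_graph_edges (n : nat) : {set {set 'I_n}} :=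
  [set e : {set 'I_n} | #|e| == 2].

Record biclique (n : nat) := Biclique {
  bleft : {set 'I_n};
  bright : {set 'I_n};
  bdisjoint : [disjoint bleft & bright]
}.

Definition biclique_edges (n : nat) (B : biclique n) : {set {set 'I_n}} :=
  [set [set x; y] | x in bleft B, y in bright B].

(* A finite collection of bicliques is a sequence, so repetitions are allowed
   and counted with multiplicity. *)
Definition odd_cover (n : nat) (C : seq (biclique n)) : Prop :=
  forall e : {set 'I_n}, e \in complete_graph_edges n ->
    odd (count (fun B => e \in biclique_edges B) C).

Definition perfect_odd_cover (k : nat) (C : seq (biclique (2 * k))) : Prop :=
  odd_cover C /\ size C = k.

(* Main.v *)
Require Import Defs.
From mathcomp Require Import all_boot.
From mathcomp Require Import ssralg ssrnum ssrint.

(**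
  Encode the position of a vertex v with respect to the k bicliques by a word
  u v with letters Some true (left side), Some false (right side) and None
  (neither).  An odd cover of K_2k by k bicliques is then a set of 2k words of
  length k such that any two of them have opposite signs in an odd number of
  coordinates.

  Necessity.  Send a set S of vertices to the parities of its intersections
  with the 2k sides X_(i,+), X_(i,-).  The pairwise oppositions form the matrix
  J - I, which is nonsingular over F_2 as 2k is even, so this map is a bijection
  onto F_2^2k.  It carries binomial(|S|, 2) mod 2, the number of edges inside
  S, to the quadratic form sum_i x_i y_i; comparing the sums of (-1)^q on both
  sides gives 2^k (-1)^binomial(k, 2) = 2^k, hence k = 0, 1 mod 4.
  Dualizing the bijection shows that all sides are odd and that sides of
  distinct bicliques meet in odd sets.  Counting edges inside one side then
  gives |X| = 1 mod 4 for k odd.  If k = 5, all sides have at least 5 elements,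
  so each biclique spans all 10 vertices, and a side of another biclique would be
  a union of two odd sets.

  Sufficiency.  Suppose that a cover comes with two words t_1, t_2 that have an
  even opposition to each other and such that every u v has odd opposition to
  t_1 or t_2.  Such a cover can be glued with a fixed cover of K_8 in which
  every word has odd opposition to exactly one of two such words s_1, s_2: pad the
  words of each cover by the t's or s's of the other so that all cross
  oppositions become odd.  The words (t_1, s_1), (t_2, s_2) allow iterating, from
  k = 4 and k = 9.
*)

Set Implicit Arguments.
Unset Strict Implicit.
Unset Printing Implicit Defensive.

(** * Words of vertices and their translation to covers *)

Definition opposed (a b : option bool) : bool :=
  if (a, b) is (Some x, Some y) then x (+) y else false.

Definition opposition (I : finType) (x y : I -> option bool) : bool :=
  \big[addb/false]_i opposed (x i) (y i).

Lemma opposedC : commutative opposed.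
Proof. by case=> [a|] [b|] //=; rewrite /opposed addbC. Qed.

Lemma oppositionC (I : finType) : commutative (@opposition I).
Proof. by move=> x y; apply: eq_bigr => i _; apply: opposedC. Qed.

Lemma opposed_eqE a b : opposed a b =
  ((a == Some true) && (b == Some false)) (+)
  ((a == Some false) && (b == Some true)).
Proof. by case: a b => [[]|] [[]|]. Qed.

Lemma opposition0 (I : finType) (x : I -> option bool) :
  opposition (fun=> None) x = false.
Proof. by rewrite /opposition big1. Qed.

(** Disjoint sides exclude that both alternatives hold, so the disjunction can be an exclusive or,
    ready for sums over F_2. *)
Lemma mem_biclique_edges n (B : biclique n) (x y : 'I_n) :
  ([set x; y] \in biclique_edges B) =
  ((x \in bleft B) && (y \in bright B)) (+) ((y \in bleft B) && (x \in bright B)).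
Proof.
have LR z : z \in bleft B -> z \in bright B = false.
  by move=> zL; rewrite (disjointFr (bdisjoint B) zL).
apply/imset2P/idP => [[a b aL bR E]|].
  have ab : a != b by apply: contraTneq bR => <-; rewrite LR.
  have xab : x \in [set a; b] by rewrite -E set21.
  have yab : y \in [set a; b] by rewrite -E set22.
  have [axy bxy] : a \in [set x; y] /\ b \in [set x; y] by rewrite E set21 set22.
  have RL : b \in bleft B = false by apply/negbTE/negP => /LR; rewrite bR.
  move: xab yab axy bxy; rewrite !inE => /orP[]/eqP-> /orP[]/eqP->;
    rewrite ?eqxx ?orbb ?[b == a]eq_sym ?(negbTE ab) //.
    by rewrite aL bR RL (LR a).
  by rewrite aL bR RL (LR a).
case: andP => [[xL yR] _|_ /andP[yL xR]]; first by exists x y.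
by exists y x => //; rewrite setUC.
Qed.

Lemma odd_coverP n (C : seq (biclique n)) :
  odd_cover C <-> forall x y : 'I_n, x != y ->
  \big[addb/false]_(B <- C) ([set x; y] \in biclique_edges B).
Proof.
have cnt (e : {set 'I_n}) : odd (count (fun B => e \in biclique_edges B) C) =
  \big[addb/false]_(B <- C) (e \in biclique_edges B).
  elim: C => [|B C IH]; first by rewrite big_nil.
  by rewrite big_cons /= oddD IH oddb.
split=> [oC x y xy|oC e].
  by rewrite -cnt; move: (oC [set x; y]); rewrite inE cards2 xy; apply.
rewrite inE => /cards2P[x [y [xy ->]]].
by rewrite cnt; apply: oC xy.
Qed.

Definition perfect_code (V I : finType) (u : V -> I -> option bool) : Prop :=
  #|V| = 2 * #|I| /\ forall v w, v != w -> opposition (u v) (u w).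

Lemma opposition_self (I : finType) (x : I -> option bool) :
  opposition x x = false.
Proof. by rewrite /opposition big1 // => i _; case: (x i) => [[]|]. Qed.

Lemma perfect_code_cover (V I : finType) (u : V -> I -> option bool) :
  perfect_code u ->
  exists C : seq (biclique (2 * #|I|)), perfect_odd_cover C.
Proof.
case=> cV uP; pose f (j : 'I_(2 * #|I|)) : V := enum_val (cast_ord (esym cV) j).
have fI : injective f by move=> x y /enum_val_inj /cast_ord_inj.
have dis i : [disjoint [set j | u (f j) i == Some true] & [set j | u (f j) i == Some false]].
  by rewrite -setI_eq0; apply/eqP/setP=> j; rewrite !inE; case: (u _ _) => [[]|].
exists [seq Biclique (dis i) | i <- enum I]; split; last by rewrite size_map cardE.
apply/odd_coverP => x y xy; rewrite big_map big_enum /=.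
have -> : \big[addb/false]_(i : I) ([set x; y] \in biclique_edges (Biclique (dis i)))
   = opposition (u (f x)) (u (f y)).
  by apply: eq_bigr => i _; rewrite mem_biclique_edges opposed_eqE /= !inE [X in _ (+) X]andbC.
by apply: uP; rewrite (inj_eq fI).
Qed.

Lemma cover_perfect_code k (C : seq (biclique (2 * k))) :
  perfect_odd_cover C ->
  exists (I : finType) (u : 'I_(2 * k) -> I -> option bool),
    #|I| = k /\ perfect_code u.
Proof.
case=> oC sC.
pose u (v : 'I_(2 * k)) (i : 'I_(size C)) := let B := tnth (in_tuple C) i in
  if v \in bleft B then Some true else if v \in bright B then Some false else None.
exists 'I_(size C), u; split; first by rewrite card_ord.
split=> [|v w vw]; first by rewrite !card_ord sC.
move/odd_coverP: oC => /(_ v w vw); rewrite big_tnth.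
congr is_true; apply: eq_bigr => i _; rewrite mem_biclique_edges /u.
set B := tnth _ _.
have LR z : z \in bleft B -> z \in bright B = false.
  by move=> zL; rewrite (disjointFr (bdisjoint B) zL).
case vL: (v \in bleft B); case wL: (w \in bleft B); rewrite ?(LR _ vL) ?(LR _ wL) //=;
  by case: (v \in bright B); case: (w \in bright B).
Qed.

(** * Parities of intersections with the sides *)

Section Necessity.

Variables (V I : finType) (u : V -> I -> option bool).
Hypothesis uP : perfect_code u.

Let evenV : odd #|V| = false.
Proof. by case: uP => -> _; rewrite mul2n odd_double. Qed.

Definition part (i : I) (b : bool) : {set V} := [set v | u v i == Some b].

Lemma part_disjoint i b : part i b :&: part i (~~ b) = set0.
Proof. by apply/setP=> v; rewrite !inE; case: (u v i) => [[]|]; case: b. Qed.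

Definition parity (S : {set V}) i b := odd #|S :&: part i b|.

Lemma odd_card_sum (S : {set V}) (P : pred V) :
  odd #|[set v in S | P v]| = \big[addb/false]_(v in S) P v.
Proof.
rewrite -sum1_card (big_morph odd oddD (erefl : odd 0 = false)).
rewrite (eq_bigl (fun v => (v \in S) && P v)) => [|v]; last by rewrite inE.
by rewrite big_mkcondr; apply: eq_bigr => v _; case: (P v).
Qed.

Lemma odd_card_addb_mem (S : {set V}) w : odd #|S| (+) (w \in S) = odd #|S :\ w|.
Proof. by rewrite (cardsD1 w S) oddD oddb addbC addbA addbb. Qed.

Lemma parityE S i b : parity S i b = \big[addb/false]_(v in S) (v \in part i b).
Proof. by rewrite -odd_card_sum. Qed.

Lemma oppositionE v w :
  opposition (u v) (u w) =
  \big[addb/false]_i ((v \in part i true) && (w \in part i false)) (+)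
  \big[addb/false]_i ((v \in part i false) && (w \in part i true)).
Proof.
by rewrite -big_split; apply: eq_bigr => i _; rewrite opposed_eqE !inE.
Qed.

Lemma opposition_neq v w : opposition (u v) (u w) = (v != w).
Proof.
case: eqVneq => [->|vw]; first exact: opposition_self.
by case: uP => _ /(_ _ _ vw) ->.
Qed.

(** This is J - I applied to the indicator of [S]: sum [opposition (u v) (u w)], which is [v != w],
    over [v] in [S] and exchange the sums. *)
Lemma odd_cardD1_parity (S : {set V}) w :
  odd #|S :\ w| = \big[addb/false]_i
    ((parity S i true && (w \in part i false)) (+)
     (parity S i false && (w \in part i true))).
Proof.
have -> : S :\ w = [set v in S | v != w] by apply/setP=> v; rewrite !inE andbC.
rewrite odd_card_sum.
under eq_bigr => v _ do rewrite -opposition_neq oppositionE -big_split /=.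
rewrite exchange_big; apply: eq_bigr => i _ /=.
by rewrite big_split !parityE !big_distrl.
Qed.

(** Equal parities make the indicators of [S] and [T] differ by a constant. The constant 1 would
    give complementary sets with sizes of different parity, although [#|V|] is even. *)
Lemma parity_inj S T : (forall i b, parity S i b = parity T i b) -> S = T.
Proof.
move=> ST; have E w : odd #|S| (+) (w \in S) = odd #|T| (+) (w \in T).
  rewrite !odd_card_addb_mem !odd_cardD1_parity; apply: eq_bigr => i _.
  by rewrite !ST.
have [oST|] := eqVneq (odd #|S|) (odd #|T|).
  by apply/setP=> w; move: (E w); rewrite oST => /addbI.
move=> oST; have TS : T = ~: S.
  apply/setP=> w; move: (E w) oST; rewrite inE.
  by case: (odd _); case: (odd _); case: (_ \in _); case: (_ \in _).
move: oST; rewrite TS; have := cardsC S; move/(congr1 odd).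
by rewrite evenV oddD; case: (odd _); case: (odd _).
Qed.

Definition parities S : {ffun I -> bool * bool} :=
  [ffun i => (parity S i true, parity S i false)].

Lemma parities_bij : bijective parities.
Proof.
apply: inj_card_bij => [S T /ffunP ST|].
  apply: parity_inj => i b; move: (ST i); rewrite !ffunE => -[].
  by case: b.
rewrite card_ffun card_prod card_bool.
have -> : #|{set V}| = 2 ^ #|V| by rewrite -[#|V|]cardsT -card_powerset powersetT cardsT.
by case: uP => -> _; rewrite expnM.
Qed.

Lemma odd_binS n : odd 'C(n.+1, 2) = odd 'C(n, 2) (+) odd n.
Proof. by rewrite binS bin1 oddD. Qed.

(** The form [a] below vanishes on the diagonal and [a v w (+) a w v] is 1 off it, so summing it
    over [S] counts each pair inside [S] once. *)
Lemma odd_bin_parity (S : {set V}) :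
  odd 'C(#|S|, 2) = \big[addb/false]_i (parity S i true && parity S i false).
Proof.
pose a v w := \big[addb/false]_i ((v \in part i true) && (w \in part i false)).
have -> : \big[addb/false]_i (parity S i true && parity S i false) =
    \big[addb/false]_(v in S) \big[addb/false]_(w in S) a v w.
  under eq_bigr => i _ do rewrite !parityE big_distrlr /=.
  rewrite exchange_big; apply: eq_bigr => v _.
  by rewrite exchange_big.
have aC v w : a v w (+) a w v = (v != w).
  rewrite -opposition_neq oppositionE; congr (_ (+) _).
  by apply: eq_bigr => i _; rewrite andbC.
have a0 v : a v v = false.
  by rewrite /a big1 // => i _; have /setP/(_ v) := part_disjoint i true; rewrite !inE.
elim: {S}_.+1 {-2}S (ltnSn #|S|) => // n IH S ltS.
have [->|[x xS]] := set_0Vmem S; first by rewrite cards0 big_set0.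
rewrite (cardsD1 x) xS add1n odd_binS (big_setD1 x xS) /= (big_setD1 x xS) /= a0.
under [X in _ = _ (+) X]eq_bigr => v _ do rewrite (big_setD1 x xS) /=.
rewrite big_split /= addbA -big_split /= IH; last first.
  by rewrite (cardsD1 x S) xS in ltS.
rewrite addbC; congr (_ (+) _).
rewrite (eq_bigr (fun v => v != x)) => [|v _]; last by rewrite addbC aC.
rewrite -odd_card_sum; congr (odd #|pred_of_set _|); apply/setP=> v.
by rewrite !inE andbAC andbb.
Qed.

Local Open Scope ring_scope.
Import GRing.Theory Num.Theory.

(** Reindexed by [parities], the sum factors over the coordinates, and each factor is 1 + 1 + 1 - 1
    = 2. *)
Lemma gauss_sum_cover :
  \sum_(S : {set V}) (-1) ^+ odd 'C(#|S|, 2) = 2%:R ^+ #|I| :> int.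
Proof.
have [g gK Kg] := parities_bij.
rewrite (reindex g) /=; last by exists parities => ? _.
transitivity (\sum_(f : {ffun I -> bool * bool})
   \prod_(i : I) (-1) ^+ ((f i).1 && (f i).2) : int).
  apply: eq_bigr => f _; rewrite odd_bin_parity -[in RHS](Kg f).
  rewrite (big_morph (fun b : bool => (-1) ^+ b : int) (id1 := 1) (op1 := *%R)) //; last first.
    by move=> x y; rewrite signr_addb.
  by apply: eq_bigr => i _; rewrite ffunE.
rewrite -(bigA_distr_bigA (fun (_ : I) (p : bool * bool) => (-1) ^+ (p.1 && p.2) : int)).
rewrite (eq_bigr (fun=> 2%:R)) => [|i _]; first by rewrite prodr_const.
by rewrite -(pair_bigA _ (fun a b : bool => (-1) ^+ (a && b) : int)) /= !big_bool.
Qed.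

Local Close Scope ring_scope.

(* The dual basis of the sides with respect to the form J - I. *)
Lemma dual_set i b : exists D : {set V}, forall j c, parity D j c = (j == i) && (c == b).
Proof.
have [g gK Kg] := parities_bij.
pose f : {ffun I -> bool * bool} := [ffun j => ((j == i) && b, (j == i) && ~~ b)].
exists (g f) => j c; have /ffunP/(_ j) := Kg f; rewrite !ffunE.
by case=> p1 p2; case: c; rewrite ?p1 ?p2; case: b {f p1 p2}.
Qed.

(** By [odd_cardD1_parity], [D] is [part i (~~ b)] or its complement, according to the parity of
    [#|D|]. The former misses [part i b], which [D] must meet oddly. *)
Lemma dual_set_unique i b (D : {set V}) :
  (forall j c, parity D j c = (j == i) && (c == b)) -> D = ~: part i (~~ b) /\ odd #|D|.
Proof.
move=> DP; have E w : odd #|D| (+) (w \in D) = (w \in part i (~~ b)).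
  rewrite odd_card_addb_mem odd_cardD1_parity (bigD1 i) //= big1 => [|j ji].
    by rewrite !DP eqxx addbF; case: (b) => //=; rewrite addbF.
  by rewrite !DP (negbTE ji).
case oD: (odd #|D|); last first.
  have DE : D = part i (~~ b) by apply/setP=> w; rewrite -E oD.
  by have := DP i b; rewrite !eqxx /parity DE setIC part_disjoint cards0.
by split=> //; apply/setP=> w; rewrite inE -E oD negbK.
Qed.

Lemma odd_part i b : odd #|part i b|.
Proof.
have [D DP] := dual_set i (~~ b); have [DE oD] := dual_set_unique DP.
move: (cardsC (part i b)) oD; rewrite DE negbK => /(congr1 odd).
by rewrite evenV oddD; case: (odd _) => //= ->.
Qed.

(** The dual set [~: part i b] meets [part j c] evenly, and [part j c] is odd. *)
Lemma odd_partI i j b c : i != j -> odd #|part i b :&: part j c|.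
Proof.
move=> ij; have [D DP] := dual_set i (~~ b); have [DE oD] := dual_set_unique DP.
have := DP j c; rewrite eq_sym (negbTE ij) /= /parity DE negbK => ev.
have := odd_part j c; rewrite -(cardsID (part i b)) oddD.
by rewrite setDE [_ :&: ~: _]setIC ev addbF setIC.
Qed.

Lemma odd_bin_part i b : odd 'C(#|part i b|, 2) = odd #|I|.-1.
Proof.
rewrite odd_bin_parity (bigD1 i) //=.
have -> : parity (part i b) i true && parity (part i b) i false = false.
  have := part_disjoint i b.
  by case: (b) => /= e; rewrite /parity e cards0 ?andbF.
rewrite (eq_bigr (fun=> true)) => [|j ji]; last first.
  by rewrite /parity !odd_partI // eq_sym.
rewrite addFb (cardD1 i) /= -sum1_card (big_morph odd oddD (erefl : odd 0 = false)).
by apply: eq_bigl => j; rewrite !inE andbT.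
Qed.

Lemma card_part_ge5 i b : odd #|I| -> 1 < #|I| -> 4 < #|part i b|.
Proof.
move=> oI I1.
have [j ij] : exists j, i != j.
  have : 0 < #|predC1 i| by rewrite cardC1; case: #|I| I1 => [|[]].
  by case/card_gt0P => j; rewrite !inE eq_sym; exists j.
have c0 c : 0 < #|part i b :&: part j c|.
  by have := odd_partI b c ij; case: #|_|.
have: 1 < #|part i b|.
  rewrite -(cardsID (part j true)) -(addn1 1) leq_add ?c0 //.
  apply: leq_trans (c0 false) (subset_leq_card _); apply/subsetP=> v.
  by rewrite !inE => /andP[-> /eqP->].
have := odd_part i b; have := odd_bin_part i b.
have -> : odd #|I|.-1 = false by case: #|I| oI => [|n] //= /negbTE.
(* The odd sizes below 5 are 1, excluded above, and 3, where binomial(3, 2) is odd. *)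
by case: #|_| => [|[|[|[|[|n]]]]].
Qed.

Lemma card_coordinates_neq5 : #|I| <> 5.
Proof.
move=> I5; have [oI I1] : odd #|I| /\ 1 < #|I| by rewrite I5.
have [i [j ij]] : exists i j : I, i != j.
  move: I1; rewrite -cardsT => /card_gt1P[i [j [_ _ ij]]]; by exists i, j.
have cU A B : A :&: B = set0 -> #|A :|: B| = #|A| + #|B| :> nat.
  by move=> AB; rewrite -(cardsUI A) AB cards0 addn0.
have disj := part_disjoint i true.
have UT : part i true :|: part i false = setT.
  apply/eqP; rewrite eqEcard subsetT cardsT /= cU //.
  case: uP => -> _; rewrite I5.
  by apply: (@leq_add 5 5); apply: card_part_ge5.
have := odd_part j true; rewrite -(setIT (part j true)) -UT setIUr.
rewrite cU; last by rewrite setIACA setIid disj setI0.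
by rewrite oddD !odd_partI // eq_sym.
Qed.

End Necessity.

(** * Evaluation of the sum of (-1)^binomial(|S|, 2) over all subsets *)

Section GaussSum.
Local Open Scope ring_scope.
Import GRing.Theory Num.Theory.

Lemma sum_bin_pascal (R : nzRingType) n (f : nat -> R) :
  \sum_(m < n.+2) f m *+ 'C(n.+1, m) =
  \sum_(m < n.+1) (f m + f m.+1) *+ 'C(n, m).
Proof.
under [RHS]eq_bigr => m _ do rewrite mulrnDl.
rewrite big_split /= [LHS]big_ord_recl [X in _ = X + _]big_ord_recl /= !bin0.
under eq_bigr => m _ do rewrite /bump /= add1n binS mulrnDr.
rewrite big_split /= addrA [X in _ + X + _]big_ord_recr /= bin_small // mulr0n addr0.
by congr (_ + _ + _).
Qed.

Lemma sum_card_bin (R : nzRingType) (V : finType) (f : nat -> R) :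
  \sum_(S : {set V}) f #|S| = \sum_(m < #|V|.+1) f m *+ 'C(#|V|, m).
Proof.
rewrite (partition_big (fun S : {set V} => inord #|S| : 'I_#|V|.+1) predT) //=.
apply: eq_bigr => m _; rewrite -card_draws -sumr_const.
have E (S : {set V}) : (inord #|S| == m) = (#|S| == m).
  by rewrite -val_eqE /= inordK // ltnS max_card.
by rewrite (eq_bigl _ _ E); apply: eq_big => [S|S /eqP->]; rewrite ?inE.
Qed.

(* So the second Pascal difference of m |-> (-1)^binomial(m, 2) is twice its shift
   by one, which explains the closed form in [gauss_sum_bin]. *)
Lemma sign_bin2_rec m :
  (-1) ^+ odd 'C(m.+2, 2) = - (-1) ^+ odd 'C(m, 2) :> int.
Proof.
by rewrite !odd_binS /= -addbA addbN addbb signr_addb mulrN1.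
Qed.

(** The shift [j] is general because the induction step uses the hypothesis at [j.+1]. *)
Lemma gauss_sum_bin k j :
  \sum_(m < (2 * k).+1) (-1) ^+ odd 'C(m + j, 2) *+ 'C(2 * k, m) =
  2%:R ^+ k * (-1) ^+ odd 'C(k + j, 2) :> int.
Proof.
elim: k j => [|k IH] j; first by rewrite big_ord1 mul1r.
rewrite mulnS (sum_bin_pascal _ (fun m => (-1) ^+ odd 'C(m + j, 2))).
rewrite (sum_bin_pascal _ (fun m => (-1) ^+ odd 'C(m + j, 2) + (-1) ^+ odd 'C(m.+1 + j, 2))).
rewrite addSnnS exprS -mulrA -IH big_distrr; apply: eq_bigr => m _ /=.
rewrite !addSn addnS sign_bin2_rec mulr_natl mulrnAC; congr (_ *+ _).
by rewrite [LHS]addrC addrA subrK mulr2n.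
Qed.

Lemma perfect_code_bin2 (V I : finType) (u : V -> I -> option bool) :
  perfect_code u -> ~~ odd 'C(#|I|, 2).
Proof.
move=> uP; have := gauss_sum_cover uP.
rewrite (sum_card_bin _ (fun m => (-1) ^+ odd 'C(m, 2) : int)).
case: (uP) => -> _; have := gauss_sum_bin #|I| 0; rewrite addn0.
under eq_bigr => m _ do rewrite addn0.
move=> -> /eqP; case: odd => //.
by rewrite mulrN1 eqNr expf_eq0 andbF.
Qed.

End GaussSum.

Lemma odd_bin2_mod4 k :
  ~~ odd 'C(k, 2) <-> k = 0 %[mod 4] \/ k = 1 %[mod 4].
Proof.
have -> : odd 'C(k, 2) = odd 'C(k %% 4, 2).
  (* Four Pascal steps add four consecutive integers, whose sum is even, so the parity has period
     4. *)
  rewrite {1}(divn_eq k 4); elim: (k %/ 4) => // q IH.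
  rewrite mulSn -addnA -IH !odd_binS /=.
  by case: (odd 'C(_, _)); case: (odd _).
have := ltn_pmod k (isT : 0 < 4).
case: (k %% 4) => [|[|[|[|]]]] //= _; split=> //;
  by [move=> _; left | move=> _; right | case].
Qed.

(** * Gluing of codes *)

Definition covering_pair (V I : finType) (u : V -> I -> option bool)
    (t : bool -> I -> option bool) : Prop :=
  opposition (t true) (t false) = false /\
  forall v, opposition (t true) (u v) || opposition (t false) (u v).

Definition extensible k : Prop :=
  exists (V I : finType) (u : V -> I -> option bool) (t : bool -> I -> option bool),
    [/\ #|I| = k, perfect_code u & covering_pair u t].

Definition concat_word (I J : finType) (x : I -> option bool) (y : J -> option bool)
    (i : I + J) : option bool :=
  match i with inl i => x i | inr j => y j end.

Lemma opposition_concat_word (I J : finType) (x x' : I -> option bool)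
    (y y' : J -> option bool) :
  opposition (concat_word x y) (concat_word x' y') = opposition x x' (+) opposition y y'.
Proof. by rewrite /opposition big_sumType. Qed.

Lemma extensible_add (k l : nat) (W J : finType) (w : W -> J -> option bool)
    (s : bool -> J -> option bool) :
  #|J| = l -> perfect_code w -> opposition (s true) (s false) = false ->
  (forall v, opposition (s true) (w v) = ~~ opposition (s false) (w v)) ->
  extensible k -> extensible (k + l).
Proof.
move=> cJ [cW wP] s0 sP [V [I [u [t [cI [cV uP] [t0 tP]]]]]].
(* The padding of [w x] is [t c] for the one [c] with [s c] oddly opposed to [w x]; that of [u v] is
   [s b] if [t b] is evenly opposed to [u v], and empty if there is no such [b]. Cross oppositions
   are then [b <> c] + [b = c], or 1 + 0. *)
pose g v := if ~~ opposition (t true) (u v) then s true else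
  if ~~ opposition (t false) (u v) then s false else fun=> None.
pose U (v : V + W) := match v with
  | inl v => concat_word (u v) (g v)
  | inr v => concat_word (t (opposition (s true) (w v))) (w v) end.
pose T b := concat_word (t b) (s b).
have tt b c : opposition (t b) (t c) = false.
  by case: b c => [] []; rewrite ?opposition_self // oppositionC.
have ss b c : opposition (s b) (s c) = false.
  by case: b c => [] []; rewrite ?opposition_self // oppositionC.
have sg b v : opposition (s b) (g v) = false.
  by rewrite /g; case: ifP => _; [|case: ifP => _]; rewrite ?ss // oppositionC opposition0.
have gg v v' : opposition (g v) (g v') = false.
  by rewrite {1}/g; case: ifP => _; [|case: ifP => _]; rewrite ?sg // opposition0.
have UVW v x : opposition (U (inl v)) (U (inr x)).
  rewrite opposition_concat_word oppositionC /g; have := sP x; have := tP v.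
  case a: (opposition (t true) (u v)); case b: (opposition (t false) (u v)) => //= _;
  by case: (opposition (s true) _) => /=; rewrite ?a ?b ?opposition0 //;
     case: (opposition (s false) _).
exists (V + W)%type, (I + J)%type, U, T; split.
- by rewrite card_sum cI cJ.
- split=> [|[v|x] [v'|x'] neq]; first by rewrite !card_sum cV cW mulnDr.
  + by rewrite opposition_concat_word gg addbF uP.
  + exact: UVW.
  + by rewrite oppositionC UVW.
  + by rewrite opposition_concat_word tt wP.
(* All oppositions among paddings are even, so [T] acts as [t] on the first code and as [s] on the
   second. *)
split=> [|[v|x]]; first by rewrite opposition_concat_word t0 s0.
  by rewrite !opposition_concat_word !sg !addbF tP.
by rewrite !opposition_concat_word !tt !addFb sP; case: opposition.
Qed.

(** * Explicit codes of lengths 4 and 9, checked by evaluation on lists *)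

Definition opposition_seq (a b : seq (option bool)) : bool :=
  foldr addb false [seq opposed x.1 x.2 | x <- zip a b].

Definition coordinates k (a : seq (option bool)) (i : 'I_k) := nth None a i.

Lemma opposition_coordinates k (a b : seq (option bool)) :
  size a = k -> size b = k ->
  opposition (@coordinates k a) (coordinates b) = opposition_seq a b.
Proof.
rewrite /opposition /coordinates.
rewrite -(big_mkord predT (fun i => opposed (nth None a i) (nth None b i))).
rewrite /opposition_seq; elim: k a b => [|k IH] [|x a] [|y b] //.
  by rewrite big_nil.
by move=> [sa] [sb]; rewrite big_nat_recl //= IH.
Qed.

Section Codewords.

Variables (k : nat) (c : seq (seq (option bool))).
Hypotheses (sc : size c = 2 * k) (szc : all (fun x => size x == k) c).

Definition codeword (v : 'I_(2 * k)) : 'I_k -> option bool :=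
  coordinates (nth [::] c v).

Let size_codeword (v : 'I_(2 * k)) : size (nth [::] c v) = k.
Proof. by apply/eqP/(allP szc)/mem_nth; rewrite sc. Qed.

Lemma perfect_codeword : pairwise opposition_seq c -> perfect_code codeword.
Proof.
move=> /(pairwiseP [::]) pc; split=> [|v w vw]; first by rewrite !card_ord.
have lt (x y : 'I_(2 * k)) : x < y -> opposition (codeword x) (codeword y).
  by move=> xy; rewrite opposition_coordinates // pc // inE sc.
case: (ltngtP v w) => [||/val_inj vw']; last by rewrite vw' eqxx in vw.
  exact: lt.
by rewrite oppositionC; apply: lt.
Qed.

Lemma opposition_codeword (a : seq (option bool)) v : size a = k ->
  opposition (coordinates a) (codeword v) = opposition_seq a (nth [::] c v).
Proof. by move=> sa; apply: opposition_coordinates. Qed.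

Lemma forall_codeword (P : pred (seq (option bool))) (v : 'I_(2 * k)) :
  all P c -> P (nth [::] c v).
Proof. by move/allP; apply; apply: mem_nth; rewrite sc. Qed.

End Codewords.

Local Notation o := (None : option bool).
Local Notation p := (Some true).
Local Notation m := (Some false).

(* These words and pairs were found by computer search; [code9] consists of two
   orbits of the cyclic shift. *)
Definition code4 :=
  [:: [:: m; m; m; o]; [:: m; p; o; m]; [:: m; o; p; p]; [:: p; m; o; p];
      [:: p; p; p; o]; [:: p; o; m; m]; [:: o; m; p; m]; [:: o; p; m; p]].

Definition pair4 (b : bool) :=
  if b then [:: m; p; p; p] else [:: p; m; m; m].

Definition code9 :=
  [seq rot i [:: o; p; o; m; o; m; p; o; m] | i <- iota 0 9] ++
  [seq rot i [:: o; o; o; p; p; o; p; m; m] | i <- iota 0 9].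

Definition pair9 (b : bool) :=
  if b then [:: o; o; o; o; m; p; o; p; m] else [:: o; o; o; m; p; o; p; m; o].

Lemma perfect_code4 : perfect_code (@codeword 4 code4).
Proof. by apply: perfect_codeword. Qed.

Lemma pair4_orthogonal :
  opposition (@coordinates 4 (pair4 true)) (coordinates (pair4 false)) = false.
Proof. by rewrite opposition_coordinates. Qed.

Lemma pair4_split (v : 'I_(2 * 4)) :
  opposition (coordinates (pair4 true)) (codeword code4 v) =
  ~~ opposition (coordinates (pair4 false)) (codeword code4 v).
Proof.
rewrite !opposition_codeword //; apply/eqP.
by apply: (@forall_codeword 4 code4 erefl (fun x =>
  opposition_seq (pair4 true) x == ~~ opposition_seq (pair4 false) x)).
Qed.

Lemma extensible4 : extensible 4.
Proof.
exists 'I_(2 * 4), 'I_4, (codeword code4), (fun b => coordinates (pair4 b)).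
split; [exact: card_ord | exact: perfect_code4 | split; first exact: pair4_orthogonal].
by move=> v; rewrite pair4_split orNb.
Qed.

Lemma extensible9 : extensible 9.
Proof.
exists 'I_(2 * 9), 'I_9, (codeword code9), (fun b => coordinates (pair9 b)).
split; [exact: card_ord | exact: perfect_codeword | split].
  by rewrite opposition_coordinates.
move=> v; rewrite !opposition_codeword //.
by apply: (@forall_codeword 9 code9 erefl (fun x =>
  opposition_seq (pair9 true) x || opposition_seq (pair9 false) x)).
Qed.

(** * All admissible lengths *)

Lemma extensible_add4n k q : extensible k -> extensible (4 * q + k).
Proof.
move=> ek; elim: q => // q IH; rewrite mulnS -addnA addnC.
apply: (extensible_add (s := fun b => coordinates (pair4 b)) _ perfect_code4) => //.
- exact: card_ord.
- exact: pair4_orthogonal.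
- exact: pair4_split.
Qed.

Lemma perfect_code_exists k : k = 0 %[mod 4] \/ k = 1 %[mod 4] -> 0 < k -> k <> 5 ->
  exists (V I : finType) (u : V -> I -> option bool), #|I| = k /\ perfect_code u.
Proof.
have ext l : extensible l -> exists (V I : finType) (u : V -> I -> option bool),
    #|I| = l /\ perfect_code u.
  by case=> V [I [u [t [cI uP _]]]]; exists V, I, u.
rewrite (divn_eq k 4) !modnMDl !modn_mod => km; rewrite mulnC.
move: (k %/ 4) => q; case: km => -> /=.
  by case: q => // q _ _; rewrite addn0 mulnSr; apply/ext/extensible_add4n/extensible4.
case: q => [_ _|[|q] // _ _].
  (* For k = 1, the ends of the single edge of K_2 get opposite signs. *)
  exists bool, unit, (fun b _ => Some b); split; first exact: card_unit.
  split=> [|v w]; first by rewrite card_bool card_unit.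
  by rewrite /opposition (big_pred1 tt) => [|[]] //; case: v w => [] [].
(* As k = 5 is excluded, the residue 1 continues from 9. *)
have -> : 4 * q.+2 + 1 = 4 * q + 9 by rewrite -(addn2 q) mulnDr -addnA.
exact/ext/extensible_add4n/extensible9.
Qed.

Theorem theorem4 (k : nat) (hk : 1 <= k) :
  (exists C : seq (biclique (2 * k)), perfect_odd_cover C) <->
  (k = 0 %[mod 4] \/ k = 1 %[mod 4]) /\ k <> 5.
Proof.
split=> [[C /cover_perfect_code[I [u [cI uP]]]]|[km k5]].
  rewrite -cI.
  by split; [exact/odd_bin2_mod4/(perfect_code_bin2 uP) | exact: card_coordinates_neq5 uP].
have [V [I [u [<- uP]]]] := perfect_code_exists km hk k5.
exact: perfect_code_cover uP.
Qed.
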